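(* Let $F$ be a cumulative distribution function on the real line with $F(0)=0$, having density $f$, such that for each $p\in\{1/4,1/2,3/4\}$ the function $F$ is differentiable at $x_p$ with $F'(x_p)=f(x_p)>0$, where $x_p=\inf\{x: F(x)\ge p\}$. Write $g(p)=1/f(x_p)$, $m=x_{1/2}$, $\mathrm{IQR}=x_{3/4}-x_{1/4}$ and $\mathrm{RCV}_Q=0.75\,\mathrm{IQR}/m$. Let $\mathcal{RCV}_Q$ be the statistical functional $\mathcal{RCV}_Q(H)=0.75\,\bigl(H^{-1}(3/4)-H^{-1}(1/4)\bigr)/H^{-1}(1/2)$. Then the asymptotic variance of the estimator of $\mathrm{RCV}_Q$, that is $\mathrm{ASV}(\mathcal{RCV}_Q,F)=\mathrm{E}_F\bigl[\mathrm{IF}^2(X;\mathcal{RCV}_Q,F)\bigr]$ with $X\sim F$, is $$\mathrm{ASV}(\mathcal{RCV}_Q,F)=\frac{\mathrm{RCV}_Q^2}{4}\left\{\frac{3\left[g^2(3/4)+g^2(1/4)\right]-2\,g(3/4)\,g(1/4)}{4\,\mathrm{IQR}^2}+\frac{g^2(1/2)}{m^2}-\frac{g(1/2)\left[g(3/4)-g(1/4)\right]}{m\,\mathrm{IQR}}\right\}.$$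
   Context: For a cumulative distribution function $H$ and $0<u<1$, the quantile function is $H^{-1}(u)=\inf\{x: H(x)\ge u\}$. The function $g(p)=1/f(x_p)$ is called the quantile density at $p$; here $g^2(p)$ means $(g(p))^2$. Influence function: for a statistical functional $\mathcal{T}$ (a real-valued function of distribution functions), a distribution function $F$ and a point $x\in\mathbb{R}$, let $F_\epsilon=(1-\epsilon)F+\epsilon\Delta_x$ for $0\le\epsilon\le 1$, where $\Delta_x$ is the distribution function of the point mass at $x$. Then $$\mathrm{IF}(x;\mathcal{T},F)=\lim_{\epsilon\downarrow 0}\frac{\mathcal{T}(F_\epsilon)-\mathcal{T}(F)}{\epsilon}.$$ Asymptotic variance: the asymptotic variance of the plug-in estimator $\mathcal{T}(F_n)$ ($F_n$ being the empirical distribution function of $n$ i.i.d. observations from $F$) is taken to be $\mathrm{ASV}(\mathcal{T},F)=\mathrm{E}_F[\mathrm{IF}^2(X;\mathcal{T},F)]$ where $X\sim F$ and $\mathrm{IF}^2$ denotes the square of the influence function. *)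

(* Defs.v *)
From HB Require Import structures.
From mathcomp Require Import all_boot all_order all_algebra.
From mathcomp Require Import all_classical all_reals all_analysis.

Set Implicit Arguments.
Unset Strict Implicit.
Unset Printing Implicit Defensive.

Import Order.TTheory GRing.Theory Num.Theory.
Import numFieldNormedType.Exports.

Local Open Scope classical_set_scope.
Local Open Scope ring_scope.

(** A distribution function is an [F : cumulativeBounded (0 : R) (1 : R)]:
    nondecreasing, right-continuous, with limits 0 at -oo and 1 at +oo.  The
    law with distribution function [F] is [lebesgue_stieltjes_measure F]. *)

Section Defs.
Context {R : realType}.

Definition quantile (H : R -> R) (u : R) : R := inf [set x | u <= H x].

Definition is_density (F f : R -> R) : Prop :=
  [/\ measurable_fun setT f,
      (forall x, 0 <= f x) &
      (forall x, (F x)%:E = \int[lebesgue_measure]_(t in `]-oo, x]) (f t)%:E)%E].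

Definition quantile_density (F f : R -> R) (p : R) : R := 1 / f (quantile F p).

Definition point_mass_cdf (x : R) : R -> R := fun y => (x <= y)%R%:R.

Definition contaminated (F : R -> R) (x eps : R) : R -> R :=
  fun y => (1 - eps) * F y + eps * point_mass_cdf x y.

(** Functionals are total on [R -> R], but below they are only evaluated at
    distribution functions: near [0^'+], [contaminated F x eps] is one. *)
Definition IF_quotient (T : (R -> R) -> R) (F : R -> R) (x eps : R) : R :=
  (T (contaminated F x eps) - T F) / eps.

(** [lim] returns a default value when there is no limit, hence the separate
    predicate [has_IF]. *)
Definition has_IF (T : (R -> R) -> R) (F : R -> R) (x : R) : Prop :=
  cvg (IF_quotient T F x eps @[eps --> 0^'+]).

Definition IF (T : (R -> R) -> R) (F : R -> R) (x : R) : R :=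
  lim (IF_quotient T F x eps @[eps --> 0^'+]).

Definition ASV (T : (R -> R) -> R) (F : cumulativeBounded (0 : R) (1 : R)) :
    \bar R :=
  ('E_(lebesgue_stieltjes_measure F)[(fun x : R => IF T F x ^+ 2)%R])%E.

Definition RCV_Q (H : R -> R) : R :=
  3 / 4 * (quantile H (3 / 4) - quantile H (1 / 4)) / quantile H (1 / 2).

End Defs.

(* Main.v *)
(** At level [p], the contaminated distribution function evaluated at
    [x_p + c eps] exceeds [p] by
    [eps (c f(x_p) - p + 1_(x <= x_p + c eps)) + o(eps)].  The bracket increases
    with [c] and changes sign at
    [L = (p 1_(x_p < x) - (1 - p) 1_(x < x_p)) / f(x_p)], so the contaminated
    quantile is squeezed between [x_p + (L - r) eps] and [x_p + (L + r) eps] for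
    every [r > 0], and [L] is its influence function.  By the quotient rule the
    influence function of [RCV_Q] is constant on each of the four intervals cut
    out by the quartiles.  These have probability [1/4] each, and the quartiles
    themselves are not atoms because [F] is continuous there. *)

Require Import Defs.
From HB Require Import structures.
From mathcomp Require Import all_boot all_order all_algebra.
From mathcomp Require Import all_classical all_reals all_analysis.
From mathcomp Require Import ring lra.

Import Order.TTheory GRing.Theory Num.Theory.
Import numFieldNormedType.Exports.

Local Open Scope classical_set_scope.
Local Open Scope ring_scope.

(** * Quantiles of nondecreasing functions *)

(** By monotonicity [a] bounds the superlevel set from below, and [b] belongs to it. Together they
    also make [inf] a genuine infimum rather than a default value. *)
Lemma quantile_between {R : realType} (H : R -> R) (a b u : R) :
  {homo H : x y / x <= y} -> H a < u -> u <= H b -> a <= quantile H u <= b.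
Proof.
move=> Hnd Hau uHb.
have lba : lbound [set x | u <= H x] a.
  move=> z /= uHz; rewrite leNgt; apply/negP => /ltW/Hnd; lra.
apply/andP; split; first by apply: lb_le_inf => //; exists b.
by apply: ge_inf => //; exists a.
Qed.

(** [H] is below [u] to the left of the quantile and at least [u] to its right; continuity passes
    both bounds to the quantile itself. *)
Lemma cdf_quantile {R : realType} (H : R -> R) (a b u : R) :
  {homo H : x y / x <= y} -> H a < u -> u <= H b ->
  {for quantile H u, continuous H} -> H (quantile H u) = u.
Proof.
move=> Hnd Hau uHb cH.
have qle z : u <= H z -> quantile H u <= z.
  by move=> uHz; have /andP[] := quantile_between _ _ _ _ Hnd Hau uHz.
have leq z : H z < u -> z <= quantile H u.
  by move=> uHz; have /andP[] := quantile_between _ _ _ _ Hnd uHz uHb.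
apply/eqP; rewrite eq_le; apply/andP; split.
- apply: (cvgr_to_le (cvg_at_left_filter cH)); near=> z.
  rewrite leNgt; apply/negP => /ltW/qle; apply/negP; rewrite -ltNge.
  by near: z; exact: nbhs_left_lt.
- apply: (cvgr_to_ge (cvg_at_right_filter cH)); near=> z.
  rewrite leNgt; apply/negP => /leq; apply/negP; rewrite -ltNge.
  by near: z; exact: nbhs_right_gt.
Unshelve. all: by end_near. Qed.

(** * Contaminated distribution functions and their quantiles *)

(** The derivative in direction [c] treats all signs of [c], and [c = 0], at once. *)
Lemma slope_cvg_right {R : realType} (F : R -> R) (a c : R) :
  derivable F a 1 ->
  (F (a + c * e) - F a) / e @[e --> 0^'+] --> c * derive1 F a.
Proof.
move=> dF; apply: cvg_dnbhs_at_right.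
have /derivable1_diffP dFa := dF.
have -> : c * derive1 F a = 'D_c F a by rewrite deriveE// diff1E.
have /(_ c) := @diff_derivable _ _ _ F a _ dFa => /(cvg_trans _); apply.
apply: near_eq_cvg; near=> e => /=.
by rewrite /GRing.scale/= mulrC [e * c]mulrC [c * e + a]addrC.
Unshelve. all: by end_near. Qed.

(* The limit of the indicator of [x <= a + c * e] as [e] decreases to 0. *)
Definition jump_limit {R : realType} (a x c : R) : R :=
  if x < a then 1 else if a < x then 0 else (0 <= c)%R%:R.

(** The quotient is [1 - e] times the slope of [F], minus [F a], plus the indicator of
    [x <= a + c * e], which is eventually constant in [e]. *)
Lemma contaminated_slope {R : realType} (F : R -> R) (a x c : R) :
  derivable F a 1 ->
  (contaminated F x e (a + c * e) - F a) / e @[e --> 0^'+] -->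
  c * derive1 F a - F a + jump_limit a x c.
Proof.
move=> dF.
have id0 : e @[e --> (0 : R)^'+] --> (0 : R).
  by apply: cvg_at_right_filter; exact: cvg_id.
have lin : a + c * e @[e --> 0^'+] --> a.
  rewrite -[X in _ --> X]addr0 -[X in _ + X](mulr0 c).
  by apply: cvgD; [exact: cvg_cst | apply: cvgM => //; exact: cvg_cst].
have jump : \forall e \near (0 : R)^'+,
    jump_limit a x c = (x <= a + c * e)%R%:R.
  rewrite /jump_limit; case: (ltgtP x a) => xa; near=> e.
  - suff : x < a + c * e by move=> /ltW ->.
    by near: e; exact: cvgr_gt lin _ xa.
  - suff : a + c * e < x by rewrite leNgt => ->.
    by near: e; exact: cvgr_lt lin _ xa.
  - have e0 : 0 < e by near: e; exact: nbhs_right_gt.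
    by rewrite xa lerDl pmulr_lge0.
have main : (1 - e) * ((F (a + c * e) - F a) / e) - F a + jump_limit a x c
    @[e --> 0^'+] --> c * derive1 F a - F a + jump_limit a x c.
  apply: cvgD; last exact: cvg_cst.
  apply: cvgD; last exact: cvg_cst.
  rewrite -[X in _ --> X]mul1r -[X in X * _ ](subr0 1).
  apply: cvgM; last exact: slope_cvg_right.
  by apply: cvgB => //; exact: cvg_cst.
apply: cvg_trans main; apply: near_eq_cvg; near=> e.
have epos : 0 < e by near: e; exact: nbhs_right_gt.
rewrite /contaminated /point_mass_cdf.
have -> : jump_limit a x c = (x <= a + c * e)%R%:R by near: e.
by field; lra.
Unshelve. all: by end_near. Qed.

(* At [x = a] the contaminated quantile does not move, hence the value [0]. *)
Definition quantile_IF {R : realType} (p a d x : R) : R :=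
  (p * (a < x)%R%:R - (1 - p) * (x < a)%R%:R) / d.

Lemma contaminated_nd {R : realType} (F : R -> R) (x e : R) :
  0 <= e <= 1 -> {homo F : y z / y <= z} ->
  {homo contaminated F x e : y z / y <= z}.
Proof.
move=> e01 Fnd y z yz; rewrite /contaminated /point_mass_cdf lerD//.
  by apply: ler_wpM2l; [lra | exact: Fnd].
apply: ler_wpM2l; first lra.
by rewrite ler_nat; case: (leP x y) => // /le_trans/(_ yz) ->.
Qed.

Lemma quantile_IF_cvg {R : realType} (F : R -> R) (p x : R) :
  0 < p < 1 -> {homo F : y z / y <= z} ->
  derivable F (quantile F p) 1 -> 0 < derive1 F (quantile F p) ->
  F (quantile F p) = p ->
  IF_quotient (quantile^~ p) F x e @[e --> 0^'+] -->
  quantile_IF p (quantile F p) (derive1 F (quantile F p)) x.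
Proof.
move=> p01 Fnd; set a := quantile F p; set d := derive1 F a => dF dpos Fa.
set L := quantile_IF _ _ _ _.
(* For [x != a] this is exactly the limit in [contaminated_slope]. At [x = a] the two differ, but
   [L = 0] and [0 < p < 1] give them the same sign whenever [c != 0]. *)
have sgn (c : R) : (c - L) * d = c * d - p + p * (1 - (a < x)%R%:R)
    + (1 - p) * (x < a)%R%:R.
  by rewrite /L /quantile_IF; field; lra.
have above c : L < c -> 0 < c * d - F a + jump_limit a x c.
  rewrite -subr_gt0 -(pmulr_lgt0 _ dpos) sgn Fa /jump_limit.
  case: (ltgtP x a) => xa /=; first lra; first lra.
  case: (leP 0 c) => c0 //=; first nra.
  have : c * d < 0 by rewrite nmulr_rlt0.
  by lra.
have below c : c < L -> c * d - F a + jump_limit a x c < 0.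
  rewrite -subr_lt0 -(pmulr_llt0 _ dpos) sgn Fa /jump_limit.
  case: (ltgtP x a) => xa /=; first lra; first lra.
  case: (leP 0 c) => c0 //=; last lra.
  have : 0 <= c * d by rewrite mulr_ge0// ltW.
  by lra.
apply/cvgrPdist_le => r r0.
have hi : L < L + r by lra.
have lo : L - r < L by lra.
near=> e.
have epos : 0 < e by near: e; exact: nbhs_right_gt.
have e1 : e <= 1 by near: e; exact: nbhs_right_le.
have hie : 0 < (contaminated F x e (a + (L + r) * e) - F a) / e.
  by near: e; exact: cvgr_gt (contaminated_slope _ _ _ _ dF) _ (above _ hi).
have loe : (contaminated F x e (a + (L - r) * e) - F a) / e < 0.
  by near: e; exact: cvgr_lt (contaminated_slope _ _ _ _ dF) _ (below _ lo).
(* The signs of the two quotients say that the contaminated function crosses [p] between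
   [a + (L - r) * e] and [a + (L + r) * e]. *)
move: hie loe; rewrite pmulr_lgt0 ?invr_gt0// pmulr_llt0 ?invr_gt0//.
rewrite Fa subr_gt0 subr_lt0 => /ltW hie loe.
have /andP[Qlo Qhi] := quantile_between _ _ _ _
  (contaminated_nd _ x e ltac:(lra) Fnd) loe hie.
have : (quantile (contaminated F x e) p - a) / e <= L + r.
  by rewrite ler_pdivrMr//; lra.
have : L - r <= (quantile (contaminated F x e) p - a) / e.
  by rewrite ler_pdivlMr//; lra.
by rewrite ler_norml /IF_quotient -/a; lra.
Unshelve. all: by end_near. Qed.

(** * Influence functions of ratios *)

Lemma IF_quotient_ratio {R : realType} (A B : (R -> R) -> R) (F : R -> R)
    (x a b : R) :
  B F != 0 ->
  IF_quotient A F x e @[e --> 0^'+] --> a ->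
  IF_quotient B F x e @[e --> 0^'+] --> b ->
  IF_quotient (fun H => A H / B H) F x e @[e --> 0^'+] -->
  (a * B F - A F * b) / (B F * B F).
Proof.
move=> BF0 Aa Bb.
(* A convergent difference quotient forces continuity along the contamination path, which also keeps
   the denominator eventually nonzero. *)
have Bcvg : B (contaminated F x e) @[e --> 0^'+] --> B F.
  have : e * IF_quotient B F x e + B F @[e --> 0^'+] --> 0 * b + B F.
    apply: cvgD; last exact: cvg_cst.
    by apply: cvgM => //; apply: cvg_at_right_filter; exact: cvg_id.
  rewrite mul0r add0r; apply: cvg_trans; apply: near_eq_cvg; near=> e.
  have e0 : e != 0 by rewrite gt_eqF//; near: e; exact: nbhs_right_gt.
  by rewrite /IF_quotient; field.
have : (IF_quotient A F x e * B F - A F * IF_quotient B F x e) /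
    (B (contaminated F x e) * B F) @[e --> 0^'+] -->
    (a * B F - A F * b) / (B F * B F).
  apply: cvgM.
    by apply: cvgB; apply: cvgM => //; exact: cvg_cst.
  apply: cvgV; first by rewrite mulf_neq0.
  by apply: cvgM => //; exact: cvg_cst.
apply: cvg_trans; apply: near_eq_cvg; near=> e.
have e0 : e != 0 by rewrite gt_eqF//; near: e; exact: nbhs_right_gt.
have Be0 : B (contaminated F x e) != 0.
  by near: e; exact: cvgr_neq0 Bcvg BF0.
by rewrite /IF_quotient; field; rewrite BF0 e0.
Unshelve. all: by end_near. Qed.

Lemma RCV_Q_IF_cvg {R : realType} (F : R -> R) (x a1 a2 a3 : R) :
  quantile F (1 / 2) != 0 ->
  IF_quotient (quantile^~ (1 / 4)) F x e @[e --> 0^'+] --> a1 ->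
  IF_quotient (quantile^~ (1 / 2)) F x e @[e --> 0^'+] --> a2 ->
  IF_quotient (quantile^~ (3 / 4)) F x e @[e --> 0^'+] --> a3 ->
  IF_quotient RCV_Q F x e @[e --> 0^'+] -->
  3 / 4 * ((a3 - a1) * quantile F (1 / 2) -
           (quantile F (3 / 4) - quantile F (1 / 4)) * a2) /
  quantile F (1 / 2) ^+ 2.
Proof.
move=> m0 q1 q2 q3.
have num : IF_quotient
    (fun H => 3 / 4 * (quantile H (3 / 4) - quantile H (1 / 4))) F x e
    @[e --> 0^'+] --> 3 / 4 * (a3 - a1).
  have : 3 / 4 * (IF_quotient (quantile^~ (3 / 4)) F x e -
      IF_quotient (quantile^~ (1 / 4)) F x e) @[e --> 0^'+] -->
      3 / 4 * (a3 - a1).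
    by apply: cvgM; [exact: cvg_cst | exact: cvgB].
  apply: cvg_trans; apply: near_eq_cvg; near=> e.
  by rewrite /IF_quotient; ring.
have := @IF_quotient_ratio _ _ (quantile^~ (1 / 2)) _ _ _ _ m0 num q2.
by congr (_ --> _); rewrite expr2; field.
Unshelve. all: by end_near. Qed.

(** * Expectations of step functions *)

(** Only linearity is used, so the sets may overlap; this allows nested rays. *)
Lemma expectation_step {d} {T : measurableType d} {R : realType}
    (P : probability T R) (s : seq (R * set T)) :
  (forall p, p \in s -> measurable p.2) ->
  ('E_P[fun x => (\sum_(p <- s) p.1 * \1_p.2 x)%R] =
   \sum_(p <- s) p.1%:E * P p.2)%E.
Proof.
move=> ms; rewrite unlock; under eq_integral do rewrite -sumEFin.
elim: s ms => [|p s IHs] ms.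
  by rewrite big_nil; under eq_integral do rewrite big_nil; rewrite integral0.
have mp : measurable p.2 by apply: ms; rewrite mem_head.
have int_step q : measurable q.2 ->
    P.-integrable setT (fun x => (q.1 * \1_q.2 x)%:E).
  move=> mq; under eq_fun do rewrite EFinM.
  by apply: integrableZl => //; exact: integrable_indic.
rewrite big_cons; under eq_integral do rewrite big_cons.
rewrite integralD//; last 2 first.
- exact: int_step.
- under eq_fun do rewrite big_seq.
  apply: integrable_sum => // q qs; apply/int_step/ms.
  by rewrite in_cons qs orbT.
rewrite IHs; last by move=> q qs; apply: ms; rewrite in_cons qs orbT.
congr (_ + _)%E; under eq_integral do rewrite EFinM.
rewrite integralZl//; last exact: integrable_indic.
by rewrite integral_indic// setIT.
Qed.

Lemma lebesgue_stieltjes_itvNy {R : realType}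
    (F : cumulativeBounded (0 : R) (1 : R)) (a : R) :
  lebesgue_stieltjes_measure F `]-oo, a] = (F a)%:E.
Proof. exact: cdf_lebesgue_stieltjes_id. Qed.

(** For [z < a] the point lies in []z, a]], of mass [F a - F z], which is arbitrarily small by
    left-continuity at [a]. *)
Lemma lebesgue_stieltjes_set1 {R : realType}
    (F : cumulativeBounded (0 : R) (1 : R)) (a : R) :
  {for a, continuous F} -> lebesgue_stieltjes_measure F [set a] = 0%E.
Proof.
move=> cF; apply/eqP; rewrite -measure_le0.
have bound z : z < a ->
    (lebesgue_stieltjes_measure F [set a] <= (F a - F z)%:E)%E.
  move=> za.
  rewrite EFinB leeBrDr// -!lebesgue_stieltjes_itvNy -measureU//.
  - apply: le_measure; rewrite ?inE//; first by apply: measurableU.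
    move=> y [->|] /=; rewrite !in_itv//=; lra.
  - by rewrite -subset0 => y [/= ->]; rewrite in_itv/=; lra.
apply/lee_addgt0Pr => r r0; rewrite add0e.
have [z za Fz] : exists2 z, z < a & F a - r < F z.
  near (a^'-) => z; exists z; first by near: z; exact: nbhs_left_lt.
  near: z; apply: cvgr_gt (cvg_at_left_filter cF) _ _; lra.
apply: le_trans (bound _ za) _; rewrite lee_fin; lra.
Unshelve. all: by end_near. Qed.

(** The values of [h] at the three quartiles are left free, since these points are null. *)
Lemma expectation_quartiles {R : realType}
    (F : cumulativeBounded (0 : R) (1 : R))
    (x1 x2 x3 c0 c1 c2 c3 : R) (h : R -> R) :
  x1 < x2 -> x2 < x3 ->
  {for x1, continuous F} -> {for x2, continuous F} -> {for x3, continuous F} ->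
  F x1 = 1 / 4 -> F x2 = 1 / 2 -> F x3 = 3 / 4 ->
  (forall x, x < x1 -> h x = c0) -> (forall x, x1 < x < x2 -> h x = c1) ->
  (forall x, x2 < x < x3 -> h x = c2) -> (forall x, x3 < x -> h x = c3) ->
  'E_(lebesgue_stieltjes_measure F)[h]%E = ((c0 + c1 + c2 + c3) / 4)%:E.
Proof.
move=> x12 x23 cF1 cF2 cF3 F1 F2 F3 h0 h1 h2 h3.
(* Rays and points instead of the intervals between quartiles: a ray has
   probability a value of [F], and a point probability zero. *)
pose s : seq (R * set R) := [:: (c3, setT);
  (c2 - c3, `]-oo, x3]%classic); (h x3 - c2, [set x3]);
  (c1 - c2, `]-oo, x2]%classic); (h x2 - c1, [set x2]);
  (c0 - c1, `]-oo, x1]%classic); (h x1 - c0, [set x1])].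
(* The coefficients telescope: each closed ray replaces the constant on its right by the next one to
   the left, and the point term then corrects the value at the endpoint. *)
have -> : h = fun x => \sum_(p <- s) p.1 * \1_p.2 x.
  apply/funext => x; rewrite /s !big_cons big_nil /= !indicE.
  have mem_ray y : (x \in (`]-oo, y]%classic : set R)) = (x <= y).
    by rewrite mem_setE in_itv.
  have mem1 y : (x \in [set y]) = (x == y).
    by apply/idP/eqP; rewrite inE.
  rewrite in_setT !mem_ray !mem1.
  case: (ltgtP x x2) => [x2x|x2x|->].
  - rewrite !(lt_eqF (lt_trans x2x x23)) (ltW (lt_trans x2x x23)).
    case: (ltgtP x x1) => [xx1|xx1|->] /=.
    + by rewrite h0//; ring.
    + by rewrite h1 ?xx1//; ring.
    + by ring.
  - rewrite (gt_eqF (lt_trans x12 x2x)) (lt_geF (lt_trans x12 x2x)).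
    case: (ltgtP x x3) => [xx3|xx3|->] /=.
    + by rewrite h2 ?x2x//; ring.
    + by rewrite h3//; ring.
    + by ring.
  - rewrite (ltW x23) (lt_eqF x23) (gt_eqF x12) (lt_geF x12) /=.
    by ring.
rewrite (expectation_step (lebesgue_stieltjes_measure F)); last first.
  move=> p; rewrite !inE.
  move=> /or4P[/eqP->|/eqP->|/eqP->|/or4P[/eqP->|/eqP->|/eqP->|/eqP->]] /=;
    solve [exact: measurableT | exact: measurable_itv | exact: measurable_set1].
rewrite /s !big_cons big_nil /= !lebesgue_stieltjes_itvNy.
rewrite !lebesgue_stieltjes_set1// F1 F2 F3 !mule0 probability_setT.
rewrite -!EFinM -!EFinD; congr _%:E; by field.
Qed.

(** * The asymptotic variance *)

Theorem theorem3p1 (R : realType) (F : cumulativeBounded (0 : R) (1 : R))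
    (f : R -> R)
    (F0 : F 0 = 0)
    (Ff : is_density F f)
    (dF : forall p : R, p \in [:: 1 / 4; 1 / 2; 3 / 4] ->
      [/\ derivable (F : R -> R) (quantile F p) 1,
          derive1 (F : R -> R) (quantile F p) = f (quantile F p) &
          0 < f (quantile F p)]) :
  let g := quantile_density F f in
  let m := quantile F (1 / 2) in
  let IQR := quantile F (3 / 4) - quantile F (1 / 4) in
  let rcv := 3 / 4 * IQR / m in
  (forall x : R, has_IF RCV_Q F x) /\
  ASV RCV_Q F =
    (rcv ^+ 2 / 4 *
      ((3 * (g (3 / 4) ^+ 2 + g (1 / 4) ^+ 2) - 2 * g (3 / 4) * g (1 / 4))
         / (4 * IQR ^+ 2)
       + g (1 / 2) ^+ 2 / m ^+ 2
       - g (1 / 2) * (g (3 / 4) - g (1 / 4)) / (m * IQR)))%:E.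
Proof.
have Fnd : {homo F : x y / x <= y} by exact: cumulative_is_nondecreasing.
have step p : 0 < p < 1 -> p \in [:: 1 / 4; 1 / 2; 3 / 4] ->
    [/\ 0 < f (quantile F p), {for quantile F p, continuous F},
        F (quantile F p) = p & forall x,
        IF_quotient (quantile^~ p) F x e @[e --> 0^'+] -->
        quantile_IF p (quantile F p) (f (quantile F p)) x].
  move=> p01 /dF[dFp fE fpos].
  have cFp : {for quantile F p, continuous F}.
    by apply: differentiable_continuous; exact/derivable1_diffP.
  have [b pFb] : exists b, p <= F b.
    near (+oo_R) => b; exists b; near: b.
    apply: cvgr_ge (cumulativey F) _ _; lra.
  have Fq : F (quantile F p) = p.
    (* The lower witness is [0], because [F 0 = 0 < p]. *)
    by apply: (@cdf_quantile _ F 0 b) => //; rewrite F0; lra.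
  split=> // x; rewrite -fE; apply: quantile_IF_cvg => //.
  by rewrite fE.
have [f1 cF1 F1 IF1] := step (1 / 4) ltac:(lra) ltac:(by rewrite !inE eqxx).
have [f2 cF2 F2 IF2] := step (1 / 2) ltac:(lra)
  ltac:(by rewrite !inE eqxx orbT).
have [f3 cF3 F3 IF3] := step (3 / 4) ltac:(lra)
  ltac:(by rewrite !inE eqxx !orbT).
move=> g m IQR rcv.
have lt_of_F x y : F x < F y -> x < y.
  by move=> Fxy; rewrite ltNge; apply/negP => /Fnd; lra.
have m0 : 0 < m by apply: lt_of_F; rewrite F0 F2; lra.
have x12 : quantile F (1 / 4) < m by apply: lt_of_F; rewrite F1 F2; lra.
have x23 : m < quantile F (3 / 4) by apply: lt_of_F; rewrite F2 F3; lra.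
have IFx x := RCV_Q_IF_cvg F x _ _ _ (lt0r_neq0 m0) (IF1 x) (IF2 x) (IF3 x).
(* The limit exists at every [x], the quartiles included, so [IF] is never a default value. *)
split; first by move=> x; apply/cvg_ex; eexists; exact: IFx.
pose K := 3 / 4 / m ^+ 2.
(* The squared influence function of [RCV_Q] in terms of those of the three quartiles. *)
pose c (j1 j2 j3 : R) := (K * ((j3 - j1) * m - IQR * j2)) ^+ 2.
pose q_IF p := quantile_IF p (quantile F p) (f (quantile F p)).
have hE x a1 a2 a3 :
    q_IF (1 / 4) x = a1 -> q_IF (1 / 2) x = a2 -> q_IF (3 / 4) x = a3 ->
    IF RCV_Q F x ^+ 2 = c a1 a2 a3.
  move=> <- <- <-; rewrite /IF (cvg_lim _ (IFx x))//.
  rewrite /c /K /q_IF -/m -/IQR; congr (_ ^+ 2); field.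
  exact: lt0r_neq0.
have left_IF p a d x : x < a -> quantile_IF p a d x = - (1 - p) / d.
  by move=> xa; rewrite /quantile_IF xa ltNge (ltW xa) /=; congr (_ / _); ring.
have right_IF p a d x : a < x -> quantile_IF p a d x = p / d.
  by move=> xa; rewrite /quantile_IF xa ltNge (ltW xa) /=; congr (_ / _); ring.
set d1 := f (quantile F (1 / 4)); set d2 := f m.
set d3 := f (quantile F (3 / 4)).
(* Crossing a quartile from left to right changes one argument of [c] from [- (1 - p) / d] to
   [p / d]. *)
rewrite /ASV (expectation_quartiles F _ _ _
  (c (- (1 - 1 / 4) / d1) (- (1 - 1 / 2) / d2) (- (1 - 3 / 4) / d3))
  (c (1 / 4 / d1) (- (1 - 1 / 2) / d2) (- (1 - 3 / 4) / d3))
  (c (1 / 4 / d1) (1 / 2 / d2) (- (1 - 3 / 4) / d3))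
  (c (1 / 4 / d1) (1 / 2 / d2) (3 / 4 / d3)) _
  x12 x23 cF1 cF2 cF3 F1 F2 F3); first last.
- by move=> x x3x; apply: hE; apply: right_IF => //; lra.
- by move=> x /andP[? ?]; apply: hE;
    [apply: right_IF | apply: right_IF | apply: left_IF] => //; lra.
- by move=> x /andP[? ?]; apply: hE;
    [apply: right_IF | apply: left_IF | apply: left_IF] => //; lra.
- by move=> x x3x; apply: hE; apply: left_IF => //; lra.
congr _%:E; rewrite /c /K /rcv /g /quantile_density -/m -/d1 -/d2 -/d3.
(* The influence values do not divide by [IQR]; the target formula does, after factoring out
   [rcv ^+ 2]. *)
have IQR0 : IQR != 0 by rewrite subr_eq0 gt_eqF//; exact: lt_trans x12 x23.
have {f1 f2 f3} : [&& IQR != 0, m != 0, d1 != 0, d2 != 0 & d3 != 0].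
  by rewrite IQR0 !lt0r_neq0.
clearbody IQR m d1 d2 d3 => nonzero.
field.
by case/and5P: nonzero => -> -> -> -> ->.
Unshelve. all: by end_near. Qed.
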